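(* Let $L$ be a lattice of finite length, let $Y$ be an RC-closed sublattice of $L$, and let $X$ be a sublattice of $Y$ such that $\operatorname{len}(X)=\operatorname{len}(Y)$. Then $Y=\mathrm{rcg}_L(X)$.
   Context: Sublattices are nonempty by convention. For elements $u,x,v$ of a lattice $L$, let $\mathrm{rc}_L(u,x,v):=\{y\in L : x\wedge y=u \text{ and } x\vee y=v\}$. A sublattice $S$ of $L$ is RC-closed (closed with respect to taking relative complements) if $\mathrm{rc}_L(u,x,v)\subseteq S$ for all $u,x,v\in S$. For $X\subseteq L$, $\mathrm{rcg}_L(X)$ denotes the least RC-closed sublattice of $L$ that includes $X$ as a subset. The length $\operatorname{len}(K)$ of a lattice $K$ is the supremum of the lengths of its finite chains, where a finite chain $C$ has length $|C|-1$; $K$ is of finite length if $\operatorname{len}(K)$ is finite. *)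

(* Defs.v *)
From mathcomp Require Import all_boot all_order all_algebra finmap.
From mathcomp Require Import boolp classical_sets constructive_ereal.

Set Implicit Arguments.
Unset Strict Implicit.
Unset Printing Implicit Defensive.

Import Order.TTheory GRing.Theory Num.Theory.

Local Open Scope classical_set_scope.
Local Open Scope order_scope.

Section LatticeNotions.
Context {d : Order.disp_t} {L : latticeType d}.

Definition sublattice (S : set L) : Prop :=
  [/\ S !=set0,
      forall x y, S x -> S y -> S (Order.meet x y)
    & forall x y, S x -> S y -> S (Order.join x y)].

Definition rc (u x v : L) : set L :=
  [set y | Order.meet x y = u /\ Order.join x y = v].

Definition RC_closed (S : set L) : Prop :=
  forall u x v, S u -> S x -> S v -> rc u x v `<=` S.

Definition RC_closed_sublattice (S : set L) : Prop :=
  sublattice S /\ RC_closed S.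

(* [smallest] is an intersection, so it is nonempty, hence itself an RC-closed
   sublattice, only when X is nonempty: see [rcg_sublattice]. *)
Definition rcg (X : set L) : set L := smallest RC_closed_sublattice X.

Definition finite_chain (K : set L) (C : {fset L}) : Prop :=
  [set` C] `<=` K /\ total_on [set` C] (fun x y => x <= y).

Definition chain_length (C : {fset L}) : int := (#|` C|%:Z - 1)%R.

(* The supremum is taken in the extended integers, so it always exists, and it
   is +oo when the finite chains of K have unbounded length: see [lenP]. The
   default value -oo is never reached since the empty chain is a finite chain
   (of length -1). *)
Definition len (K : set L) : \bar int :=
  supremum -oo%E [set (chain_length C)%:E | C in finite_chain K].

Definition finite_length (K : set L) : Prop := len K \is a fin_num.

Lemma lenP (K : set L) :
  supremums [set (chain_length C)%:E | C in finite_chain K] (len K).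
Proof.
set A := [set _ | _ in _].
have A0 : A (chain_length fset0)%:E by exists fset0 => //; split=> x /=.
have -> : len K = xget -oo%E (supremums A).
  rewrite /len /supremum ifF //; apply/negbTE/set0P.
  by exists (chain_length fset0)%:E.
apply: xgetPex.
pose P n := `[< exists2 C, finite_chain K C & #|` C| = n >].
have exP : exists n, P n.
  by exists 0%N; apply/asboolP; exists fset0; rewrite ?cardfs0//; split=> x /=.
have [[m bndP]|unbP] := pselect (exists m, forall n, P n -> (n <= m)%N).
  have [n /asboolP[C KC Cn] nmax] := ex_maxnP exP bndP.
  exists (chain_length C)%:E; split=> [_ [D KD <-]|y]; last by apply; exists C.
  rewrite lee_fin lerD2r lez_nat Cn; apply: nmax.
  by apply/asboolP; exists D.
exists +oo%E; split=> [y _|[z| |] ub]; rewrite ?leey //; last first.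
  by have := ub _ A0.
exfalso; apply: unbP; exists (absz (z + 1)%R) => _ /asboolP[C KC <-].
have := ub (chain_length C)%:E (ex_intro2 _ _ C KC erefl).
rewrite lee_fin lerBlDr => Cz; rewrite -lez_nat.
exact: le_trans Cz (lez_abs _).
Qed.

Lemma rcg_sublattice (X : set L) : X !=set0 -> RC_closed_sublattice (rcg X).
Proof.
move=> [x Xx]; split; first split.
- by exists x; apply: sub_gen_smallest.
- move=> a b Sa Sb A AX; have [[[_ Am _] _] _] := AX.
  exact: Am (Sa A AX) (Sb A AX).
- move=> a b Sa Sb A AX; have [[[_ _ Aj] _] _] := AX.
  exact: Aj (Sa A AX) (Sb A AX).
- move=> u a v Su Sa Sv y yrc A AX; have [[_ Arc] _] := AX.
  exact: Arc (Su A AX) (Sa A AX) (Sv A AX) _ yrc.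
Qed.

End LatticeNotions.

(* Main.v *)
Require Import Defs.
From mathcomp Require Import all_boot all_order all_algebra finmap.
From mathcomp Require Import boolp classical_sets constructive_ereal.

(** The equality of lengths yields a finite chain C in X that is a maximal
    chain of Y: as len X is finite, some chain C in X attains it, and
    a chain of Y properly including C would be longer than len Y = len X
    ([finite_chain_longest_exists], [longest_chain_saturated]).

    Let S be an RC-closed set including C. Then every y in Y belongs to S
    ([saturated_chain_RC_closed]). Climb C from the bottom, showing that the
    meet of y and c is in S for every c in C. At the bottom of C, this meet is
    below all of C, so it is in C by maximality. In a step from b to the next
    element c of C, the element z = meet y c satisfies meet b z = meet b y,
    which is in S by induction. The join of b and z lies between b and c,
    hence is b or c by maximality. If it is b, then z = meet b y; if it is c,
    then z is a relative complement of b between meet b y and c, and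
    RC-closedness applies. At the top of C, the meet is y itself.

    For S = rcg X this gives that Y is included in rcg X; the other inclusion
    holds because Y is an RC-closed sublattice including X. *)

Set Implicit Arguments.
Unset Strict Implicit.
Unset Printing Implicit Defensive.

Import Order.TTheory GRing.Theory Num.Theory.

Local Open Scope classical_set_scope.
Local Open Scope order_scope.

Section Chains.
Context {d : Order.disp_t} {L : latticeType d}.
Implicit Types (K S X Y : set L) (C : {fset L}).

(** For a chain C of Y, this says that C is a maximal chain of Y. *)
Definition saturated Y C : Prop :=
  forall z, Y z -> (forall c, c \in C -> z >=< c) -> z \in C.

Lemma finite_chain_has_max C (P : pred L) :
    total_on [set` C] (fun x y => x <= y) ->
    (exists2 c, c \in C & P c) ->
  exists m, [/\ m \in C, P m & forall c, c \in C -> P c -> c <= m].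
Proof.
move=> Ctot exP.
suff H (s : seq L) : {subset s <= C} -> (exists2 c, c \in s & P c) ->
    exists m, [/\ m \in s, P m & forall c, c \in s -> P c -> c <= m].
  by apply: H exP.
elim: s => [|x s IHs] sC; first by case.
have sC' : {subset s <= C} by move=> c cs; apply: sC; rewrite inE cs orbT.
have xC : x \in C by apply: sC; rewrite inE eqxx.
case: (boolP (has P s)) => [/hasP exs _|/hasPn nPs [c]].
  have [m [ms Pm mmax]] := IHs sC' exs.
  case: (boolP (P x && (m <= x))) => [/andP[Px mx]|nPx].
    exists x; split=> // [|c]; rewrite inE ?eqxx// => /predU1P[->//|cs Pc].
    exact: le_trans (mmax c cs Pc) mx.
  exists m; split=> // [|c]; first by rewrite inE ms orbT.
  rewrite inE => /predU1P[-> Px|cs]; last exact: mmax.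
  move: nPx; rewrite Px /= => nmx.
  by have [//|mx] := Ctot x m xC (sC' m ms); rewrite mx in nmx.
rewrite inE => /predU1P[-> Px|cs Pc]; last first.
  by have := nPs c cs; rewrite Pc.
exists x; split=> // [|c']; rewrite inE ?eqxx// => /predU1P[->//|cs' Pc'].
by have := nPs c' cs'; rewrite Pc'.
Qed.

(** Every y in Y is reached from C by relative complements: as c climbs C,
    meet y c is first an element of C, and then either stays the same or
    becomes a relative complement of the previous element of C. *)
Lemma saturated_chain_RC_closed S Y C :
  sublattice Y -> finite_chain Y C -> saturated Y C ->
  RC_closed S -> [set` C] `<=` S -> Y `<=` S.
Proof.
move=> [_ Ymeet Yjoin] [CY Ctot] Csat Src CS y Yy.
(* The induction is on the number of elements of C below c. *)
have climb n c : c \in C -> (#|` [fset x in C | (x < c)%O]%fset| < n)%N ->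
    S (Order.meet y c).
  elim: n c => [//|n IHn] c cC cn.
  have [exb|nexb] := pselect (exists2 b, b \in C & b < c); last first.
    (* c is the bottom of C, so meet y c is below all of C. *)
    apply/CS/Csat => [|x xC]; first exact: Ymeet Yy (CY _ cC).
    have cx : c <= x.
      have [//|] := Ctot c x cC xC; rewrite le_eqVlt => /predU1P[->//|xc].
      by case: nexb; exists x.
    by rewrite /Order.comparable (le_trans (leIr c y) cx).
  have [b [bC bc bmax]] := finite_chain_has_max Ctot exb.
  have Sb : S (Order.meet y b).
    apply: (IHn b bC); rewrite -ltnS; apply: leq_trans cn; rewrite ltnS.
    apply: fproper_ltn_card; rewrite fproperEneq; apply/andP; split.
      apply/eqP => /fsetP/(_ b).
      by rewrite !inE /= bC bc ltxx.
    apply/fsubsetP => x; rewrite !inE /= => /andP[-> xb].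
    exact: lt_trans xb bc.
  set z := Order.meet y c.
  have bz : Order.meet b z = Order.meet y b.
    by rewrite /z meetCA (meet_l (ltW bc)).
  have jc : Order.join b z <= c by rewrite leUx (ltW bc) leIr.
  have jC : Order.join b z \in C.
    apply: Csat => [|x xC].
      exact: Yjoin (CY _ bC) (Ymeet _ _ Yy (CY _ cC)).
    rewrite /Order.comparable.
    have [cx|xc] := Ctot c x cC xC; first by rewrite (le_trans jc cx).
    move: xc; rewrite le_eqVlt => /predU1P[->|xc]; first by rewrite jc.
    by rewrite (le_trans (bmax x xC xc) (leUl b z)) orbT.
  move: jc; rewrite le_eqVlt => /predU1P[jE|jc].
    (* z is a relative complement of b between meet y b and c. *)
    exact: (Src _ _ _ Sb (CS _ bC) (CS _ cC)).
  (* As b is the predecessor of c in C, the join is b. *)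
  have zb : z <= b by apply: le_trans (leUr z b) (bmax _ jC jc).
  by rewrite -(meet_r zb) bz.
(* If C is empty, saturation puts y itself in C. *)
have [[c0 c0C]|C0] := pselect (exists c, c \in C); last first.
  by apply/CS/Csat => // c cC; case: C0; exists c.
have [|t [tC _ tmax]] := finite_chain_has_max (P := predT) Ctot.
  by exists c0.
(* The top t of C is the top of Y: the join of y and t is above all of C, so
   it is in C. *)
have yt : y <= t.
  apply: le_trans (leUl y t) (tmax _ _ isT).
  apply: Csat => [|c cC]; first exact: Yjoin Yy (CY _ tC).
  by rewrite /Order.comparable (le_trans (tmax c cC isT) (leUr t y)) orbT.
by rewrite -(meet_l yt); apply: climb tC (ltnSn _).
Qed.

Lemma chain_length_le_len K C :
  finite_chain K C -> ((chain_length C)%:E <= len K)%E.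
Proof. by move=> KC; apply: (lenP K).1; exists C. Qed.

Lemma le_len X Y : X `<=` Y -> (len X <= len Y)%E.
Proof.
move=> XY; apply: (lenP X).2 => _ [C [CX Ctot] <-].
by apply: chain_length_le_len; split=> //; apply: subset_trans XY.
Qed.

Lemma finite_length_sub X Y : X `<=` Y -> finite_length Y -> finite_length X.
Proof.
move=> /le_len; have : ((chain_length (fset0 : {fset L}))%:E <= len X)%E.
  by apply: chain_length_le_len; split=> x.
by rewrite /finite_length; case: (len X) => [r| |] //; case: (len Y).
Qed.

(** Lengths are integers: if the supremum n of the lengths were not attained,
    n - 1 would be a smaller upper bound. *)
Lemma finite_chain_longest_exists K : finite_length K ->
  exists2 C, finite_chain K C & (chain_length C)%:E = len K.
Proof.
rewrite /finite_length; have [ub lub] := lenP K.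
case: (len K) ub lub => [n| |] // ub lub _.
apply: contrapT => nex.
suff : (n%:E <= (n - 1)%R%:E)%E by rewrite lee_fin lerBrDr gerDl.
apply: lub => _ [C KC <-].
have := ub _ (ex_intro2 _ _ C KC erefl).
rewrite !lee_fin lerBrDr lezD1 le_eqVlt => /predU1P[Cn|//].
by case: nex; exists C; rewrite ?Cn.
Qed.

(** An element of Y outside C and comparable to all of C would extend C to a
    chain longer than len Y. *)
Lemma longest_chain_saturated Y C :
  finite_chain Y C -> (chain_length C)%:E = len Y -> saturated Y C.
Proof.
move=> [CY Ctot] Clen z Yz zC; apply: contrapT => /negP zNC.
have : finite_chain Y (z |` C)%fset.
  split=> [x|x y] /=; rewrite !inE; first by case/predU1P => [->//|/CY].
  case/predU1P => [->|xC] /predU1P[->|yC]; first by left.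
  - exact/orP/zC.
  - by apply/orP; rewrite orbC; apply: zC.
  - exact: Ctot.
move/chain_length_le_len; rewrite -Clen lee_fin /chain_length.
by rewrite cardfsU1 zNC lerD2r lez_nat add1n ltnn.
Qed.

End Chains.

Theorem lemma1 (d : Order.disp_t) (L : latticeType d) (X Y : set L)
  (finL : finite_length [set: L])
  (Ysub : sublattice Y) (Yrc : RC_closed Y)
  (Xsub : sublattice X) (XY : X `<=` Y)
  (lenXY : len X = len Y) :
  Y = rcg X.
Proof.
have [C [CX Ctot] Clen] :=
  finite_chain_longest_exists (finite_length_sub (@subsetT _ X) finL).
have CY : finite_chain Y C by split=> //; apply: subset_trans XY.
rewrite lenXY in Clen.
apply/seteqP; split; last exact: smallest_sub.
have [X0 _ _] := Xsub; have [_ Src] := rcg_sublattice X0.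
apply: (saturated_chain_RC_closed Ysub CY _ Src).
  exact: longest_chain_saturated CY Clen.
by apply: subset_trans CX _; apply: sub_gen_smallest.
Qed.
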